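(* For all $\beta>1/2$ and all $f\in\mathcal{C}^\infty_c(\mathbb{R})$, $$\operatorname{Ent}_{\mu_\beta}(f^2)\leq\frac{2}{2\beta-1}\int_{\mathbb{R}} (f')^2\,\omega\left(\frac{2\beta}{2\beta-1}+\log(\omega)\right)d\mu_\beta.$$
   Context: $\mathcal{C}_c^\infty(\mathbb{R})$ is the set of smooth compactly supported functions on $\mathbb{R}$. For $\beta>1/2$, $\mu_\beta$ is the generalised Cauchy probability measure on $\mathbb{R}$ with density proportional to $(1+x^2)^{-\beta}$. $\omega(x)=1+x^2$. For a probability measure $\nu$ and $g\ge0$, $\operatorname{Ent}_\nu(g)=\int g\log g\,d\nu-\left(\int g\,d\nu\right)\log\left(\int g\,d\nu\right)$ (with $0\log 0=0$). *)

(* Defs.v *)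
From HB Require Import structures.
From mathcomp Require Import all_boot all_order all_algebra.
From mathcomp Require Import all_classical all_reals all_analysis.
From mathcomp Require Import measurable_realfun.
From mathcomp Require Import ring lra.

Set Implicit Arguments.
Unset Strict Implicit.
Unset Printing Implicit Defensive.
Import Order.TTheory GRing.Theory Num.Theory.
Import numFieldNormedType.Exports.
Local Open Scope classical_set_scope.
Local Open Scope ring_scope.

Definition smooth_compact_support (R : realType) (f : R -> R) : Prop :=
  (forall (n : nat) (x : R), derivable (f^`(n))%classic x 1) /\
  compact (closure [set x | f x != 0]).

(* The integrals are real-valued (and [fine] sends infinite ones to 0), so this
   is the entropy only when [g] and [g ln g] are integrable, which is the case
   for a bounded measurable nonnegative [g]. *)
Definition entropy d (T : measurableType d) (R : realType)
    (nu : probability T R) (g : T -> R) : R :=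
  \int[nu]_x (g x * ln (g x)) - (\int[nu]_x g x) * ln (\int[nu]_x g x).

(* The weight omega is the library's [oneDsqr : x |-> 1 + x ^+ 2]. *)
Section generalised_cauchy.
Variables (R : realType) (b : R).
Local Notation mu := (@lebesgue_measure R).

Definition gcauchy_fun (x : R) : R := oneDsqr x `^ (- b).

Definition gcauchy_mass : R := \int[mu]_x gcauchy_fun x.

Definition gcauchy_pdf (x : R) : R := gcauchy_fun x / gcauchy_mass.

Lemma gcauchy_fun_ge0 x : 0 <= gcauchy_fun x.
Proof. exact: powR_ge0. Qed.

Lemma continuous_gcauchy_fun : continuous gcauchy_fun.
Proof.
move=> x; apply: (continuous_comp (f := @oneDsqr R) (g := @powR R ^~ (- b))).
  exact: continuous_oneDsqr.
apply/differentiable_continuous/derivable1_diffP/derivable_powR.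
by rewrite in_itv/= andbT (lt_le_trans ltr01)// oneDsqr_ge1.
Qed.

Lemma measurable_gcauchy_fun : measurable_fun setT gcauchy_fun.
Proof. by apply: continuous_measurable_fun; exact: continuous_gcauchy_fun. Qed.

Lemma gcauchy_mass_ge0 : 0 <= gcauchy_mass.
Proof. by apply: Rintegral_ge0 => // x _; exact: gcauchy_fun_ge0. Qed.

Lemma gcauchy_pdf_ge0 x : 0 <= gcauchy_pdf x.
Proof. by rewrite divr_ge0 ?gcauchy_fun_ge0 ?gcauchy_mass_ge0. Qed.

Lemma measurable_gcauchy_pdf : measurable_fun setT gcauchy_pdf.
Proof. by apply: measurable_funM => //; exact: measurable_gcauchy_fun. Qed.

Let majorant (x : R) : R := 2 `^ b * (1 + x) `^ (- (2 * b)).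

Let primitive (x : R) : R :=
  - (2 `^ b / (2 * b - 1)) * (1 + x) `^ (- (2 * b - 1)).

Let gcauchy_fun_le (x : R) : 2^-1 < b -> 0 <= x -> gcauchy_fun x <= majorant x.
Proof.
move=> hb x0.
have o0 : 0 < oneDsqr x by rewrite (lt_le_trans ltr01)// oneDsqr_ge1.
have x1 : 0 < 1 + x by lra.
rewrite /majorant /gcauchy_fun !powRN powRrM.
rewrite (_ : (1 + x) `^ 2 = (1 + x) ^+ 2); last first.
  by rewrite -powR_mulrn// ltW.
rewrite ler_pdivlMr ?powR_gt0 ?exprn_gt0//.
rewrite ler_pdivrMl ?powR_gt0// -powRM; [|exact: ltW|by []].
apply: ge0_ler_powR; rewrite ?nnegrE; first by lra.
- exact: sqr_ge0.
- by apply: mulr_ge0 => //; exact: ltW.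
- by rewrite /oneDsqr; have := sqr_ge0 (x - 1); nra.
Qed.

Let is_derive_powR1D (p x : R) : 0 < 1 + x ->
  is_derive x 1 (fun y : R => (1 + y) `^ p) (p * (1 + x) `^ (p - 1)).
Proof.
move=> x0; have := is_derive1_powR p x0 => dp.
have d1 : is_derive x 1 (fun y : R => 1 + y) 1.
  by rewrite -[X in is_derive _ _ _ X]add0r; exact: is_deriveD.
by have := @is_derive1_comp _ _ _ _ _ _ dp d1; rewrite mulr1.
Qed.

Let primitive_derive (x : R) : 2^-1 < b -> 0 < 1 + x ->
  is_derive x 1 primitive (majorant x).
Proof.
move=> hb x0; have dp := is_derive_powR1D (- (2 * b - 1)) x0.
have := is_deriveZ (- (2 `^ b / (2 * b - 1))) dp.
rewrite /majorant.
rewrite [X in is_derive _ _ _ X -> _](_ : _ = majorant x) //.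
rewrite /majorant /GRing.scale/= (_ : - (2 * b - 1) - 1 = - (2 * b)); last by ring.
by field; lra.
Qed.

Let majorant_continuous (x : R) : 0 < 1 + x -> {for x, continuous majorant}.
Proof.
move=> x0; apply: continuousM; first exact: cvg_cst.
apply/differentiable_continuous/derivable1_diffP.
exact: (@ex_derive _ _ _ _ _ _ _ (is_derive_powR1D _ x0)).
Qed.

Let primitive_cvgy : 2^-1 < b -> primitive x @[x --> +oo] --> 0.
Proof.
move=> hb; rewrite -[X in _ --> X](mulr0 (- (2 `^ b / (2 * b - 1)))).
apply: cvgM; first exact: cvg_cst.
apply: (@cvg_trans _ (expR (- (ln (1 + x) * (2 * b - 1))) @[x --> +oo])).
  apply: near_eq_cvg; near=> x.
  have x0 : 0 < 1 + x by rewrite ltr_pwDl.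
  by rewrite /powR gt_eqF// mulNr [in RHS]mulrC.
apply: (@cvg_comp _ _ _ (fun x : R => ln (1 + x) * (2 * b - 1))
  (fun y => expR (- y)) _ (@pinfty_nbhs R)); last exact: cvgr_expR.
apply: gt0_cvgMly; first lra.
apply/cvgryPge => A; near=> x.
have eA := expR_gt0 A.
have xA : expR A <= x by near: x; apply: nbhs_pinfty_ge; exact: num_real.
by rewrite -ler_expR lnK ?posrE; lra.
Unshelve. all: by end_near. Qed.

Lemma gcauchy_fun_integralT_lty : 2^-1 < b ->
  (\int[mu]_x (gcauchy_fun x)%:E < +oo)%E.
Proof.
move=> hb; rewrite ge0_symfun_integralT.
- apply: lte_mul_pinfty => //.
  rewrite -set_itvcy.
  apply: (@le_lt_trans _ _ (\int[mu]_(x in `[0%R, +oo[) (majorant x)%:E)%E).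
    apply: ge0_le_integral => //=.
    + by move=> x _; rewrite lee_fin gcauchy_fun_ge0.
    + by apply/measurable_EFinP/measurable_funTS; exact: measurable_gcauchy_fun.
    + apply/measurable_EFinP/measurable_funTS; apply: measurable_funM => //.
      apply: (measurableT_comp (f := @powR R ^~ (- (2 * b)))).
        exact: measurable_powR.
      exact: measurable_funD.
    + by move=> x; rewrite in_itv/= andbT => x0; rewrite lee_fin gcauchy_fun_le.
  rewrite (@ge0_continuous_FTC2y _ majorant primitive 0 0) ?ltry//.
  + by move=> x _; rewrite mulr_ge0 ?powR_ge0.
  + apply: continuous_in_subspaceT => x.
    rewrite inE/= in_itv/= andbT => x0; apply: majorant_continuous; lra.
  + exact: primitive_cvgy.
  + move=> x x0; have x1 : 0 < 1 + x by lra.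
    exact: (@ex_derive _ _ _ _ _ _ _ (primitive_derive hb x1)).
  + apply: cvg_at_right_filter.
    apply/differentiable_continuous/derivable1_diffP.
    have x1 : 0 < 1 + 0 :> R by lra.
    exact: (@ex_derive _ _ _ _ _ _ _ (primitive_derive hb x1)).
  + move=> x; rewrite in_itv/= andbT => x0; have x1 : 0 < 1 + x by lra.
    by rewrite derive1E; apply: (@derive_val _ _ _ _ _ _ _ (primitive_derive hb x1)).
- exact: gcauchy_fun_ge0.
- exact: continuous_gcauchy_fun.
- by move=> x; rewrite /gcauchy_fun /oneDsqr /= sqrrN.
Qed.

Lemma gcauchy_fun_integralT : 2^-1 < b ->
  (\int[mu]_x (gcauchy_fun x)%:E = gcauchy_mass%:E)%E.
Proof.
move=> hb; rewrite /gcauchy_mass /Rintegral fineK// ge0_fin_numE.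
  exact: gcauchy_fun_integralT_lty.
by apply: integral_ge0 => x _; rewrite lee_fin gcauchy_fun_ge0.
Qed.

Lemma gcauchy_mass_gt0 : 2^-1 < b -> 0 < gcauchy_mass.
Proof.
move=> hb; rewrite -lte_fin -gcauchy_fun_integralT//.
apply: (@lt_le_trans _ _ (\int[mu]_(x in `[0%R, 1%R]) (2 `^ (- b))%:E)%E).
  rewrite integral_cst//= lebesgue_measure_itv/= lte01 oppr0 adde0 mule1.
  by rewrite lte_fin powR_gt0.
apply: (@le_trans _ _ (\int[mu]_(x in `[0%R, 1%R]) (gcauchy_fun x)%:E)%E).
  apply: ge0_le_integral => //=.
  + by apply/measurable_EFinP/measurable_funTS; exact: measurable_gcauchy_fun.
  + move=> x; rewrite in_itv/= => /andP[x0 x1].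
    have o0 : 0 < oneDsqr x by rewrite (lt_le_trans ltr01)// oneDsqr_ge1.
    rewrite lee_fin /gcauchy_fun !powRN lef_pV2 ?posrE ?powR_gt0//.
    apply: ge0_ler_powR; rewrite ?nnegrE//; first by lra.
    by rewrite /oneDsqr; nra.
apply: ge0_subset_integral => //=.
  by apply/measurable_EFinP; exact: measurable_gcauchy_fun.
by move=> x _; rewrite lee_fin gcauchy_fun_ge0.
Qed.

Lemma integral_gcauchy_pdf : 2^-1 < b ->
  (\int[mu]_x (gcauchy_pdf x)%:E = 1)%E.
Proof.
move=> hb; rewrite /gcauchy_pdf.
under eq_integral do rewrite EFinM.
rewrite ge0_integralZr//=.
- rewrite gcauchy_fun_integralT// -EFinM divff// gt_eqF//.
  exact: gcauchy_mass_gt0.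
- by apply/measurable_EFinP; exact: measurable_gcauchy_fun.
- by move=> x _; rewrite lee_fin gcauchy_fun_ge0.
- by rewrite lee_fin invr_ge0 gcauchy_mass_ge0.
Qed.

End generalised_cauchy.

Definition gcauchy_prob (R : realType) (b : R) (hb : 2^-1 < b) :
    set R -> \bar R :=
  fun A => (\int[lebesgue_measure]_(x in A) (gcauchy_pdf b x)%:E)%E.

Section generalised_cauchy_probability.
Variables (R : realType) (b : R) (hb : 2^-1 < b).

Let gcauchy0 : gcauchy_prob hb set0 = 0%E.
Proof. exact: integral_set0. Qed.

Let gcauchy_ge0 A : (0 <= gcauchy_prob hb A)%E.
Proof. by apply: integral_ge0 => x _; rewrite lee_fin gcauchy_pdf_ge0. Qed.

Let gcauchy_sigma_additive : semi_sigma_additive (gcauchy_prob hb).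
Proof.
move=> /= F mF tF mUF; rewrite /gcauchy_prob; apply: cvg_toP.
  apply: ereal_nondecreasing_is_cvgn => m n mn.
  apply: lee_sum_nneg_natr => // k _ _.
  by apply: integral_ge0 => /= x Fkx; rewrite lee_fin gcauchy_pdf_ge0.
rewrite ge0_integral_bigcup//=.
- apply: measurable_funTS; apply: measurableT_comp => //.
  exact: measurable_gcauchy_pdf.
- by move=> x _; rewrite lee_fin gcauchy_pdf_ge0.
Qed.

HB.instance Definition _ := isMeasure.Build _ _ _ (gcauchy_prob hb)
  gcauchy0 gcauchy_ge0 gcauchy_sigma_additive.

Let gcauchy_setT : gcauchy_prob hb [set: R] = 1%E.
Proof. exact: integral_gcauchy_pdf. Qed.

HB.instance Definition _ := @Measure_isProbability.Build _ _ R
  (gcauchy_prob hb) gcauchy_setT.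

End generalised_cauchy_probability.

(* Main.v *)
Require Import Defs.
From HB Require Import structures.
From mathcomp Require Import all_boot all_order all_algebra.
From mathcomp Require Import all_classical all_reals all_analysis.
From mathcomp Require Import measurable_realfun.
From mathcomp Require Import ring lra.

Set Implicit Arguments.
Unset Strict Implicit.
Unset Printing Implicit Defensive.
Import Order.TTheory GRing.Theory Num.Theory.
Import numFieldNormedType.Exports.
Local Open Scope classical_set_scope.
Local Open Scope ring_scope.

(** The inequality is a Bakry-Emery logarithmic Sobolev inequality in disguise.
Write [p] for the density, [omega] for [1 + x^2], and put
[h^2 = omega (2 b / (2 b - 1) + ln omega) / (2 b - 1)], so that the claim reads
[Ent (f^2) <= 2 int (f')^2 h^2 p]. In the coordinate [Y] with [Y' = 1 / h] the
energy becomes the usual one and the density becomes [p h]; the weight is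
such that [- ln (p h)] has second derivative at least [1] in this coordinate
(lemma [cauchy_curvature]). It remains to prove, in one dimension, that a
density which is at least as log-concave as the standard Gaussian one satisfies
the logarithmic Sobolev inequality with the Gaussian constant.

This is done by optimal transport, after Cordero-Erausquin. Fix a segment
[[l, r]] and a positive [g] of mean [m] for [p]. The increasing map [T] which
pushes [g p / m] to [p] satisfies [T' p(T) = g p / m] (lemma
[monotone_transport]). Let [th = Y o T - Y]. Strong log-concavity compares [p h]
at [T x] with its second order expansion at [x] (lemma [strong_log_concavity]);
together with [ln s <= s - 1] for [s = h T' / h(T)], it bounds [ln (g / m)]
above by an expression which is affine in [T'], and completing a square gives
pointwise
  [g ln (g / m) p <= (g p h th)' + (g'^2 / (2 g)) h^2 p].
Since [T] fixes both end points, [th] vanishes there, and integrating over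
[[l, r]] yields the inequality on the segment (lemma [log_sobolev_segment]).
Working on a segment is what makes the boundary terms vanish exactly.

The case of [g = f^2], which may vanish, follows by applying this to [f^2 + e]
and letting [e] tend to [0] (lemma [log_sobolev_segment_sqr]). Finally the
segment is taken to be [[-n, n]]: once it contains the support of [f], only its
mass depends on [n], and that mass tends to [1]. *)

(** * Calculus of one real variable *)

Section calculus.
Context {R : realType}.
Implicit Types (a l r x : R) (f F : R -> R).
Local Notation mu := (@lebesgue_measure R).

Lemma is_derive_continuous f x (df : R) : is_derive x 1 f df ->
  {for x, continuous f}.
Proof.
by move=> [d _]; apply/differentiable_continuous/derivable1_diffP.
Qed.

Lemma is_derive_within_continuous F f l r :
  (forall x, l <= x <= r -> is_derive x 1 F (f x)) ->
  {within `[l, r]%classic, continuous F}.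
Proof.
move=> dF; apply: continuous_in_subspaceT => x; rewrite inE/= in_itv/= => xlr.
exact: is_derive_continuous (dF x xlr).
Qed.

Lemma continuous_funM (f g : R -> R) : continuous f -> continuous g ->
  continuous (fun x => f x * g x).
Proof. by move=> cf cg x; apply: continuousM; [exact: cf|exact: cg]. Qed.

Lemma continuous_funD (f g : R -> R) : continuous f -> continuous g ->
  continuous (fun x => f x + g x).
Proof. by move=> cf cg x; apply: continuousD; [exact: cf|exact: cg]. Qed.

Lemma continuous_funB (f g : R -> R) : continuous f -> continuous g ->
  continuous (fun x => f x - g x).
Proof. by move=> cf cg x; apply: continuousB; [exact: cf|exact: cg]. Qed.

Lemma continuous_fun_cst (c : R) : continuous (fun _ : R => c).
Proof. exact: cst_continuous. Qed.

Lemma continuous_funV f : (forall x, f x != 0) -> continuous f ->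
  continuous (fun x => (f x)^-1).
Proof. by move=> f0 cf x; apply: continuousV; [exact: f0|exact: cf]. Qed.

Lemma continuous_integrable_segment f l r : continuous f ->
  mu.-integrable `[l, r]%classic (EFin \o f).
Proof.
move=> cf; apply: continuous_compact_integrable; first exact: segment_compact.
exact: continuous_subspaceT.
Qed.

(** The primitive is only claimed on a half-line, so that it can be taken to be
an integral with a fixed lower end point. *)
Lemma primitive_exists a f : continuous f ->
  exists F, forall x, a < x -> is_derive x 1 F (f x).
Proof.
move=> cf; exists (fun x => \int[mu]_(t in `[a, x]) f t) => x ax.
have [] := @continuous_FTC1_closed R f a x (x + 1) _ _ ax (cf x).
- by rewrite ltrDl.
- exact: continuous_integrable_segment.
by move=> dF F'; split => //; rewrite -derive1E.
Qed.

Lemma Rintegral_segment f F l r : l < r -> continuous f ->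
  (forall x, l <= x <= r -> is_derive x 1 F (f x)) ->
  \int[mu]_(x in `[l, r]) f x = F r - F l.
Proof.
move=> lr cf dF; rewrite /Rintegral (@continuous_FTC2 R f F l r)//.
- exact: continuous_subspaceT.
- split.
  + move=> x; rewrite in_itv/= => /andP[lx xr].
    by have [] := dF x; rewrite ?ltW.
  + apply: cvg_at_right_filter; apply: is_derive_continuous (dF l _).
    by rewrite lexx ltW.
  + apply: cvg_at_left_filter; apply: is_derive_continuous (dF r _).
    by rewrite lexx ltW.
- move=> x; rewrite in_itv/= => /andP[lx xr].
  by rewrite derive1E; have [] := dF x; rewrite ?ltW.
Qed.

Lemma is_derive_ge0_le F f l r : l <= r ->
  (forall x, l <= x <= r -> is_derive x 1 F (f x)) ->
  (forall x, l <= x <= r -> 0 <= f x) -> F l <= F r.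
Proof.
move=> lr dF f0.
have [||c] := @MVT_segment _ F f l r lr.
- by move=> x; rewrite in_itv/= => /andP[lx xr]; apply: dF; rewrite !ltW.
- exact: is_derive_within_continuous dF.
rewrite in_itv/= => clr H; rewrite -subr_ge0 H mulr_ge0 ?subr_ge0//.
exact: f0.
Qed.

Lemma is_derive_gt0_lt F f l r : l < r ->
  (forall x, l <= x <= r -> is_derive x 1 F (f x)) ->
  (forall x, l <= x <= r -> 0 < f x) -> F l < F r.
Proof.
move=> lr dF f0.
have [||c] := @MVT _ F f l r lr.
- by move=> x; rewrite in_itv/= => /andP[lx xr]; apply: dF; rewrite !ltW.
- exact: is_derive_within_continuous dF.
rewrite in_itv/= => /andP[lc cr] H; rewrite -subr_gt0 H mulr_gt0 ?subr_gt0//.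
by apply: f0; rewrite !ltW.
Qed.

(** At [0], where [ln] is not continuous, the function is squeezed between
[- 2 sqrt |t|] and [0], because [ln] is sublinear at [1 / sqrt t]. *)
Lemma continuous_xlnx : continuous (fun t : R => t * ln t).
Proof.
move=> x; have [x0|x0|->] := ltgtP x 0; last 1 first.
- rewrite /prop_for /continuous_at mul0r.
  apply: (squeeze_cvgr (f := fun t : R => - (2 * Num.sqrt `|t|))
                       (h := fun=> 0)).
  + near=> t.
    have t1 : t < 1 by near: t; exact: lt_nbhsl.
    have [t0|t0] := leP t 0.
      by rewrite ln0// mulr0 oppr_le0 mulr_ge0// lexx.
    have st0 : 0 < Num.sqrt t by rewrite sqrtr_gt0.
    rewrite gtr0_norm// mulr_ge0_le0 ?(ltW t0) ?ln_le0 ?(ltW t1)//= andbT.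
    have tE : t = Num.sqrt t ^+ 2 by rewrite sqr_sqrtr// ltW.
    move: (Num.sqrt t) st0 tE => s s0 ->.
    have : ln s^-1 <= s^-1 by apply/ltW/ln_sublinear; rewrite invr_gt0.
    rewrite lnV ?posrE// -(ler_pM2l (exprn_gt0 2 s0)) lnXn// mulr2n.
    by rewrite [X in X / s]expr2 mulfK ?gt_eqF//; lra.
  + have E0 : - (2 * Num.sqrt `|0 : R|) = 0.
      by rewrite normr0 sqrtr0 mulr0 oppr0.
    rewrite -[X in _ --> X]E0.
    apply: cvgN; apply: cvgM; first exact: cvg_cst.
    apply: (continuous_comp (f := fun t : R => `|t|)).
      exact: norm_continuous.
    exact: sqrt_continuous.
  + exact: cvg_cst.
- rewrite /prop_for /continuous_at ln0 ?(ltW x0)// mulr0.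
  apply: (@cvg_trans _ ((fun _ : R => 0 : R) t @[t --> nbhs x])).
    2: exact: cvg_cst.
  apply: near_eq_cvg; near=> t; rewrite ln0 ?mulr0//.
  by apply: ltW; near: t; exact: lt_nbhsl.
- apply: continuousM; first exact: cvg_id.
  exact: continuous_ln.
Unshelve. all: by end_near. Qed.

Lemma is_derive1_fun_cst (c x : R) : is_derive x 1 (fun _ : R => c) 0.
Proof. exact: is_derive_cst. Qed.

Lemma ln_le_subr1 (y : R) : 0 < y -> ln y <= y - 1.
Proof.
by move=> y0; rewrite -[y in ln y](subrK 1) addrC; apply: le_ln1Dx; lra.
Qed.

Lemma is_derive1_funD (f g : R -> R) x (df dg : R) :
  is_derive x 1 f df -> is_derive x 1 g dg ->
  is_derive x 1 (fun y => f y + g y) (df + dg).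
Proof. exact: is_deriveD. Qed.

Lemma is_derive1_funBc f x (c df : R) :
  is_derive x 1 f df -> is_derive x 1 (fun y => f y - c) df.
Proof.
move=> Df; rewrite -[df]subr0; exact: (is_deriveB Df (is_derive_cst c x 1)).
Qed.

Lemma is_derive1_funB (f g : R -> R) x (df dg : R) :
  is_derive x 1 f df -> is_derive x 1 g dg ->
  is_derive x 1 (fun y => f y - g y) (df - dg).
Proof. exact: is_deriveB. Qed.

Lemma is_derive1_funM (f g : R -> R) x (df dg : R) :
  is_derive x 1 f df -> is_derive x 1 g dg ->
  is_derive x 1 (fun y => f y * g y) (df * g x + f x * dg).
Proof.
move=> Df Dg; rewrite addrC [df * _]mulrC; exact: (is_deriveM Df Dg).
Qed.

Lemma is_derive1_funZ f x (c df : R) :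
  is_derive x 1 f df -> is_derive x 1 (fun y => c * f y) (c * df).
Proof. exact: is_deriveZ. Qed.

Lemma is_derive1_funV f x (df : R) : f x != 0 ->
  is_derive x 1 f df -> is_derive x 1 (fun y => (f y)^-1) (- df / f x ^+ 2).
Proof.
by move=> fx0 Df; rewrite mulNr mulrC -mulNr; exact: (is_deriveV fx0 Df).
Qed.

Lemma is_derive1_fun_ln f x (df : R) : 0 < f x ->
  is_derive x 1 f df -> is_derive x 1 (fun y => ln (f y)) (df / f x).
Proof.
move=> f0 Df; rewrite mulrC.
exact: (is_derive1_comp (f := @ln R) (is_derive1_ln f0) Df).
Qed.

(** If [P] and [Q] are primitives of positive functions with the same values at
[l] and [r], then [T] is the inverse of [P] composed with [Q]. Both primitives
are defined a little to the left of [l], which makes [T] differentiable at the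
end points as well. *)
Lemma monotone_transport a l r (P Q p q : R -> R) : a < l -> l < r ->
  (forall x, a < x -> is_derive x 1 P (p x)) ->
  (forall x, a < x -> is_derive x 1 Q (q x)) ->
  (forall x, 0 < p x) -> (forall x, 0 < q x) ->
  P l = Q l -> P r = Q r ->
  exists T : R -> R, [/\ T l = l, T r = r &
    forall x, l <= x <= r ->
      l <= T x <= r /\ is_derive x 1 T (q x / p (T x))].
Proof.
move=> al lr dP dQ p0 q0 PQl PQr.
have Pmono x y : a < x -> x < y -> P x < P y.
  move=> ax xy; apply: (is_derive_gt0_lt (f := p) xy) => z // /andP[xz _].
  by apply: dP; exact: lt_le_trans xz.
have Pinj x y : a < x -> a < y -> P x = P y -> x = y.
  move=> ax ay PE; case: (ltgtP x y) => // xy.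
    by have := Pmono _ _ ax xy; rewrite PE ltxx.
  by have := Pmono _ _ ay xy; rewrite PE ltxx.
pose S y := xget l [set t | a < t /\ P t = y]%classic.
have SK t : a < t -> S (P t) = t.
  move=> at_; rewrite /S; case: xgetP => [z _ [az Pz]|/(_ t)]; last first.
    by move=> /= H; exfalso; apply: H.
  exact: Pinj Pz.
have TE x : l <= x <= r -> exists2 t, l <= t <= r & P t = Q x.
  move=> /andP[lx xr].
  have [||t] := @IVT _ P l r (Q x) (ltW lr).
  - apply: (@is_derive_within_continuous P p) => z /andP[lz _].
    by apply: dP; exact: lt_le_trans lz.
  - have Qm u v : a < u -> u <= v -> Q u <= Q v.
      move=> au uv; apply: (is_derive_ge0_le (f := q) uv) => z; last first.
        by move=> _; exact: ltW.
      by move=> /andP[uz _]; apply: dQ; exact: lt_le_trans uz.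
    rewrite PQl PQr minEle maxEle (Qm _ _ al (ltW lr)).
    by rewrite !Qm//; exact: lt_le_trans lx.
  by rewrite in_itv/= => tlr Pt; exists t.
exists (S \o Q); split => /=.
- by rewrite -PQl SK.
- by rewrite -PQr SK//; exact: lt_trans lr.
move=> x xlr; have [t tlr Pt] := TE _ xlr.
have at_ : a < t by case/andP: tlr => + _; exact: lt_le_trans.
have ax : a < x by case/andP: xlr => + _; exact: lt_le_trans.
rewrite -Pt SK//; split=> //.
rewrite mulrC; apply: is_derive1_comp; last exact: dQ.
rewrite -Pt; apply: is_derive_inverse.
- near=> z; apply: SK; near: z; exact: lt_nbhsr.
- near=> z; apply: (is_derive_continuous (dP _ _)); near: z; exact: lt_nbhsr.
- exact: dP.
- by rewrite gt_eqF.
Unshelve. all: by end_near. Qed.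

End calculus.

(** * Logarithmic Sobolev inequality for strongly log-concave densities *)

Section lsi.
Context {R : realType}.
Local Notation mu := (@lebesgue_measure R).

Section density.
(** In a coordinate [Y] with [Y' = 1 / h], differentiation is [h d/dx] and the
density is [p h]. Hence [k] is the first derivative of [- ln (p h)] in that
coordinate, and the last hypothesis bounds its second derivative below
by [1]. *)
Variables (p dp h dh k dk : R -> R).
Hypothesis dpE : forall x : R, is_derive x 1 p (dp x).
Hypothesis dhE : forall x : R, is_derive x 1 h (dh x).
Hypothesis dkE : forall x : R, is_derive x 1 k (dk x).
Hypothesis p0 : forall x, 0 < p x.
Hypothesis h0 : forall x, 0 < h x.
Hypothesis kE : forall x, k x = - (h x * dp x / p x + dh x).
Hypothesis curv : forall x, 1 <= h x * dk x.

(** The function [ln (p h) + k(x) (Y - Y x) + (Y - Y x)^2 / 2] is maximal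
at [x]: its derivative at [t] has the sign of [B x - B t], where [B = k - Y] is
nondecreasing by the curvature bound. *)
Lemma strong_log_concavity (a x t : R) (Y : R -> R) :
  (forall y, a < y -> is_derive y 1 Y (h y)^-1) -> a < x -> a < t ->
  ln (p t) + ln (h t) + k x * (Y t - Y x) + (Y t - Y x) ^+ 2 / 2
    <= ln (p x) + ln (h x).
Proof.
move=> dY ax at_.
pose A y := ln (p y) + ln (h y) + k x * (Y y - Y x) + (Y y - Y x) ^+ 2 / 2.
pose B y := k y - Y y.
have dA y : a < y -> is_derive y 1 A ((B x - B y) / h y).
  move=> ay.
  have d1 := is_derive1_fun_ln (p0 y) (dpE y).
  have d2 := is_derive1_fun_ln (h0 y) (dhE y).
  have d3 := is_derive1_funBc (Y x) (dY y ay).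
  have d4 := is_derive1_funZ (k x) d3.
  have d5 := is_derive1_funM (is_derive1_funM d3 d3)
                             (is_derive1_fun_cst 2^-1 y).
  have d6 := is_derive1_funD (is_derive1_funD (is_derive1_funD d1 d2) d4) d5.
  have d6' : is_derive (y : R) 1 A _ := d6.
  apply: (is_derive_eq d6').
  rewrite /B /cst !kE; field; rewrite ?gt_eqF//.
have Bmono u v : a < u -> u <= v -> B u <= B v.
  move=> au uv; apply: (is_derive_ge0_le (f := fun z => dk z - (h z)^-1) uv).
    move=> z /andP[uz _].
    exact: (is_derive1_funB (dkE z) (dY z (lt_le_trans au uz))).
  by move=> z _; rewrite subr_ge0 -(@ler_pM2l _ (h z))// divff ?curv// gt_eqF.
suff : A t <= A x by rewrite /A !subrr mulr0 expr0n/= mul0r !addr0.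
have [xt|tx] := leP x t.
- rewrite -lerN2.
  apply: (@is_derive_ge0_le _ (fun z => - A z)
            (fun z => - ((B x - B z) / h z))) => //.
    move=> z /andP[xz _].
    by apply: is_deriveN; apply: dA; exact: lt_le_trans xz.
  move=> z /andP[xz _]; rewrite -mulNr opprB divr_ge0 ?(ltW (h0 _))// subr_ge0.
  exact: Bmono.
- apply: (is_derive_ge0_le (f := fun z => (B x - B z) / h z) (ltW tx)).
    by move=> z /andP[tz _]; apply: dA; exact: lt_le_trans tz.
  move=> z /andP[tz zx]; rewrite divr_ge0 ?(ltW (h0 _))// subr_ge0.
  by apply: Bmono => //; exact: lt_le_trans tz.
Qed.

(** [H] is the difference of the two integrals from [l] to [x], plus the
boundary term [g p h th] of the integration by parts. It is shown to be
nondecreasing, and its boundary term is zero at both ends because [T] fixes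
them. Proceeding by monotonicity rather than by an integration by parts spares
the integrability of [T']. *)
Lemma log_sobolev_segment (g dg : R -> R) (l r m : R) : l < r ->
  (forall x : R, is_derive x 1 g (dg x)) -> continuous dg ->
  (forall x, 0 < g x) ->
  m = (\int[mu]_(x in `[l, r]) (g x * p x)) / \int[mu]_(x in `[l, r]) p x ->
  \int[mu]_(x in `[l, r]) (g x * ln (g x / m) * p x) <=
  2^-1 * \int[mu]_(x in `[l, r]) (dg x ^+ 2 / g x * h x ^+ 2 * p x).
Proof.
move=> lr dgE cdg g0 mE.
have al : l - 1 < l by lra.
have cp : continuous p by move=> x; exact: is_derive_continuous (dpE x).
have ch : continuous h by move=> x; exact: is_derive_continuous (dhE x).
have cg : continuous g by move=> x; exact: is_derive_continuous (dgE x).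
have cgp : continuous (fun x => g x * p x).
  exact: continuous_funM.
have [P dP] := primitive_exists (l - 1) cp.
have [G dG] := primitive_exists (l - 1) cgp.
have [Y dY] : exists Y, forall x, l - 1 < x -> is_derive x 1 Y (h x)^-1.
  apply: (primitive_exists (l - 1) (f := fun x => (h x)^-1)).
  by apply: continuous_funV ch => x; rewrite gt_eqF.
have atl x : l <= x <= r -> l - 1 < x by move=> /andP[lx _]; lra.
have Pint : \int[mu]_(x in `[l, r]) p x = P r - P l.
  by apply: Rintegral_segment => // x /atl; exact: dP.
have Gint : \int[mu]_(x in `[l, r]) (g x * p x) = G r - G l.
  by apply: Rintegral_segment => // x /atl; exact: dG.
have P0 : 0 < P r - P l.
  by rewrite subr_gt0; apply: (is_derive_gt0_lt (f := p) lr) => // x /atl/dP.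
have G0 : 0 < G r - G l.
  rewrite subr_gt0.
  apply: (is_derive_gt0_lt lr (fun x xlr => dG x (atl x xlr))).
  by move=> x _; rewrite mulr_gt0.
have m0 : 0 < m by rewrite mE Pint Gint divr_gt0.
pose q x := m^-1 * (g x * p x).
pose Q x := m^-1 * (G x - G l) + P l.
have q0 x : 0 < q x by rewrite !mulr_gt0 ?invr_gt0.
have dQ x : l - 1 < x -> is_derive x 1 Q (q x).
  move=> ax; rewrite /q -[_ * _]addr0.
  have d1 := is_derive1_funZ m^-1 (is_derive1_funBc (G l) (dG x ax)).
  exact: (is_derive1_funD d1 (is_derive1_fun_cst (P l) x)).
have [||T [Tl Tr dT]] := monotone_transport al lr dP dQ p0 q0.
- by rewrite /Q subrr mulr0 add0r.
- rewrite /Q mE Pint Gint invf_div; field; lra.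
pose k1 x := g x * ln (g x / m) * p x.
pose k2 x := dg x ^+ 2 / g x * h x ^+ 2 * p x.
have ck1 : continuous k1.
  move=> x.
  have d1 := is_derive1_funM (dgE x) (is_derive1_fun_cst m^-1 x).
  have d2 := @is_derive1_fun_ln _ (fun y => g y / m) x _
    (divr_gt0 (g0 x) m0) d1.
  exact: is_derive_continuous
    (is_derive1_funM (is_derive1_funM (dgE x) d2) (dpE x)).
have ck2 : continuous k2.
  apply: continuous_funM cp; apply: continuous_funM (continuous_funM ch ch).
  apply: (continuous_funM (continuous_funM cdg cdg)).
  by apply: continuous_funV cg => x; rewrite gt_eqF.
have [K1 dK1] := primitive_exists (l - 1) ck1.
have [K2 dK2] := primitive_exists (l - 1) ck2.
rewrite (Rintegral_segment lr ck1 (fun x xlr => dK1 x (atl x xlr))).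
rewrite (Rintegral_segment lr ck2 (fun x xlr => dK2 x (atl x xlr))).
pose H x := 2^-1 * K2 x - K1 x + g x * p x * h x * (Y (T x) - Y x).
suff : H l <= H r by rewrite /H Tl Tr !subrr !mulr0 !addr0; lra.
pose th x := Y (T x) - Y x.
pose s x := q x / p (T x) / h (T x).
have dH x : l <= x <= r -> is_derive x 1 H
    (2^-1 * k2 x - k1 x + (((dg x * p x + g x * dp x) * h x +
      g x * p x * dh x) * th x + g x * p x * h x * (s x - (h x)^-1))).
  move=> xlr; have [Tlr dTx] := dT x xlr.
  have d1 := is_derive1_funB (is_derive1_funZ 2^-1 (dK2 _ (atl _ xlr)))
                             (dK1 _ (atl _ xlr)).
  have d2 := is_derive1_funM (is_derive1_funM (dgE x) (dpE x)) (dhE x).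
  have d3 := is_derive1_comp (dY _ (atl _ Tlr)) dTx.
  have d4 := is_derive1_funB d3 (dY _ (atl _ xlr)).
  apply: is_derive_eq (is_derive1_funD d1 (is_derive1_funM d2 d4)) _.
  by rewrite /th /s [(h (T x))^-1 * _]mulrC.
apply: (is_derive_ge0_le (ltW lr) dH) => x xlr.
have [Tlr _] := dT x xlr.
have conc := strong_log_concavity dY (atl _ xlr) (atl _ Tlr).
rewrite -/(th x) in conc.
have s0 : 0 < s x by rewrite !divr_gt0.
(* [s x * h x] is the derivative of the transport map in the coordinate [Y]. *)
have lns : ln (g x / m) + ln (p x) + ln (h x) - ln (p (T x)) - ln (h (T x))
    <= s x * h x - 1.
  suff -> : ln (g x / m) + ln (p x) + ln (h x) - ln (p (T x)) - ln (h (T x)) =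
    ln (s x * h x) by apply: ln_le_subr1; rewrite mulr_gt0.
  rewrite /s /q !ln_div ?lnM ?posrE ?mulr_gt0 ?invr_gt0 ?divr_gt0//
    ?lnM ?lnV ?posrE ?mulr_gt0 ?invr_gt0 ?divr_gt0//.
  ring.
have lng : ln (g x / m) <= s x * h x - 1 - k x * th x - th x ^+ 2 / 2 by lra.
have gp0 : 0 < g x * p x by rewrite mulr_gt0.
have sq : 0 <= 2^-1 * (p x / g x) * (dg x * h x + g x * th x) ^+ 2.
  by rewrite mulr_ge0 ?sqr_ge0// mulr_ge0 ?divr_ge0 ?ltW.
(* What is left is the square of [dg h + g th], up to a positive factor. *)
apply: (le_trans sq).
have : g x * p x * ln (g x / m) <= 
       g x * p x * (s x * h x - 1 - k x * th x - th x ^+ 2 / 2).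
  by rewrite ler_pM2l.
rewrite /k1 /k2 -subr_ge0 => {}lng; rewrite -subr_ge0.
apply: (le_trans lng); rewrite le_eqVlt; apply/orP; left; apply/eqP.
rewrite kE; field; rewrite !gt_eqF//.
Qed.

(** For [g = f^2 + e] the Fisher information [g'^2 / g] is at most [4 f'^2], and
[g ln g >= f^2 ln f^2 + e ln e], so letting [e] tend to [0] only takes the
continuity of [t ln t]. *)
Lemma log_sobolev_segment_sqr (f df : R -> R) (l r Z m : R) : l < r ->
  (forall x : R, is_derive x 1 f (df x)) -> continuous df ->
  Z = \int[mu]_(x in `[l, r]) p x ->
  m = (\int[mu]_(x in `[l, r]) (f x ^+ 2 * p x)) / Z ->
  (\int[mu]_(x in `[l, r]) (f x ^+ 2 * ln (f x ^+ 2) * p x) <=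
  2 * \int[mu]_(x in `[l, r]) (df x ^+ 2 * h x ^+ 2 * p x) + Z * (m * ln m))%R.
Proof.
move=> lr dfE cdf ZE mdef.
have cp : continuous p by move=> x; exact: is_derive_continuous (dpE x).
have ch : continuous h by move=> x; exact: is_derive_continuous (dhE x).
have cf : continuous f by move=> x; exact: is_derive_continuous (dfE x).
have cf2 : continuous (fun x => f x ^+ 2) by exact: continuous_funM.
have cffp := continuous_funM cf2 cp.
have cE : continuous (fun x => f x ^+ 2 * ln (f x ^+ 2) * p x).
  apply: continuous_funM cp => x.
  exact: (continuous_comp (cf2 x) (@continuous_xlnx R (f x ^+ 2))).
have cI : continuous (fun x => df x ^+ 2 * h x ^+ 2 * p x).
  apply: continuous_funM cp.
  exact: (continuous_funM (continuous_funM cdf cdf) (continuous_funM ch ch)).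
have int u : continuous u -> mu.-integrable `[l, r] (EFin \o u).
  exact: continuous_integrable_segment.
have Z0 : 0 < Z.
  have [P dP] := primitive_exists (l - 1) cp.
  have dP' x : l <= x <= r -> is_derive x 1 P (p x).
    by move=> /andP[lx _]; apply: dP; lra.
  rewrite ZE (Rintegral_segment lr cp dP') subr_gt0.
  exact: is_derive_gt0_lt dP' _.
set E := (X in X <= _); set I := \int[mu]_(x in _) (_ * _ * _).
have main e : 0 < e ->
    E <= 2 * I + Z * ((m + e) * ln (m + e)) - Z * (e * ln e).
  move=> e0.
  pose g x := f x ^+ 2 + e.
  pose dg x := df x * f x + f x * df x.
  have dgE (x : R) : is_derive x 1 g (dg x).
    rewrite -[dg x]addr0.
    exact: (is_derive1_funD (is_derive1_funM (dfE x) (dfE x))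
             (is_derive1_fun_cst e x)).
  have cg : continuous g by move=> x; exact: is_derive_continuous (dgE x).
  have g0 x : 0 < g x by rewrite ltr_wpDl// sqr_ge0.
  have cdg : continuous dg.
    exact: continuous_funD (continuous_funM cdf cf) (continuous_funM cf cdf).
  have mE : m + e = (\int[mu]_(x in `[l, r]) (g x * p x)) /
      \int[mu]_(x in `[l, r]) p x.
    rewrite -ZE /g; under eq_Rintegral do rewrite mulrDl.
    rewrite RintegralD//; last 2 first.
    - exact: int.
    - by apply: int; apply: continuous_funM cp; exact: continuous_fun_cst.
    rewrite RintegralZl//; last exact: int.
    by rewrite mdef mulrDl -ZE mulfK// gt_eqF.
  have m0 : 0 < m + e.
    rewrite ltr_wpDl// mdef divr_ge0 ?(ltW Z0)//; apply: Rintegral_ge0 => x _.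
    by rewrite mulr_ge0 ?sqr_ge0 ?(ltW (p0 _)).
  have := log_sobolev_segment lr dgE cdg g0 mE.
  set A := (X in X <= _) => H.
  have cgp := continuous_funM cg cp.
  have lo : E + Z * (e * ln e) - Z * ((m + e) * ln (m + e)) <= A.
    pose j x := f x ^+ 2 * ln (f x ^+ 2) * p x + (e * ln e) * p x
      - ln (m + e) * (g x * p x).
    have cep : continuous (fun x => e * ln e * p x).
      by apply: continuous_funM cp; exact: continuous_fun_cst.
    have cmp : continuous (fun x => ln (m + e) * (g x * p x)).
      by apply: continuous_funM cgp; exact: continuous_fun_cst.
    have cEe : continuous (fun x =>
        f x ^+ 2 * ln (f x ^+ 2) * p x + (e * ln e) * p x).
      exact: continuous_funD.
    have cj : continuous j.
      exact: continuous_funB.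
    have -> : E + Z * (e * ln e) - Z * ((m + e) * ln (m + e)) =
        \int[mu]_(x in `[l, r]) j x.
      rewrite /j RintegralB//; [|exact: int..].
      rewrite RintegralD//; [|exact: int..].
      rewrite !RintegralZl//; [|exact: int..].
      have -> : \int[mu]_(x in `[l, r]) (g x * p x) = (m + e) * Z.
        by rewrite mE -ZE divfK// gt_eqF.
      by rewrite -ZE -/E; ring.
    apply: le_Rintegral => //.
    + exact: int.
    + apply: int => x.
      have d1 := is_derive1_funM (dgE x) (is_derive1_fun_cst (m + e)^-1 x).
      have d2 := @is_derive1_fun_ln _ (fun y => g y / (m + e)) x _
        (divr_gt0 (g0 x) m0) d1.
      exact: is_derive_continuous
        (is_derive1_funM (is_derive1_funM (dgE x) d2) (dpE x)).
    + move=> x _; rewrite /j ln_div ?posrE// mulrBr !mulrBl.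
      rewrite [ln _ * (_ * _)]mulrCA mulrA lerB// -mulrDl ler_pM2r//.
      rewrite /g mulrDl lerD//.
        have [->|f0] := eqVneq (f x) 0; first by rewrite expr0n/= !mul0r.
        have ff0 : 0 < f x ^+ 2 by rewrite exprn_even_gt0.
        by rewrite ler_pM2l// ler_ln ?posrE// ?lerDl ?ltW// ltr_wpDl ?ltW.
      by rewrite ler_pM2l// ler_ln ?posrE//; [rewrite lerDr sqr_ge0|exact: g0].
  have up : \int[mu]_(x in `[l, r]) (dg x ^+ 2 / g x * h x ^+ 2 * p x)
     <= 4 * I.
    rewrite /I -RintegralZl//; last exact: int.
    apply: le_Rintegral => //.
    + apply: int; apply: continuous_funM cp.
      apply: continuous_funM; last exact: (continuous_funM ch ch).
      apply: continuous_funM; first exact: (continuous_funM cdg cdg).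
      by apply: continuous_funV cg => x; rewrite gt_eqF.
    + by apply: int; apply: continuous_funM cI; exact: continuous_fun_cst.
    + move=> x _; have -> : 4 * (df x ^+ 2 * h x ^+ 2 * p x) =
          (4 * df x ^+ 2) * h x ^+ 2 * p x by ring.
      rewrite ler_pM2r//.
      apply: ler_wpM2r; first exact: sqr_ge0.
      rewrite ler_pdivrMr// /dg /g.
      have := sqr_ge0 (df x); nra.
  lra.
pose phi (t : R) := t * ln t.
apply: (@ler_cvg_to _ (0^'+) _ _ (fun _ : R => E)
  (fun e => 2 * I + Z * phi (m + e) - Z * phi e)).
- exact: cvg_cst.
- have phi0 : phi 0 = 0 by rewrite /phi mul0r.
  have -> : 2 * I + Z * (m * ln m) = 2 * I + Z * phi (m + 0) - Z * phi 0.
    by rewrite phi0 mulr0 subr0 addr0.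
  apply: cvg_at_right_filter.
  have cphi1 : continuous (fun e : R => phi (m + e)).
    move=> e; apply: (continuous_comp (f := fun e : R => m + e)).
      by apply: continuousD; [exact: cst_continuous|exact: cvg_id].
    exact: continuous_xlnx.
  have cont := continuous_funB (continuous_funD (@continuous_fun_cst R (2 * I))
    (continuous_funM (@continuous_fun_cst R Z) cphi1))
    (continuous_funM (@continuous_fun_cst R Z) (@continuous_xlnx R)).
  exact: (cont 0).
- by near=> e; apply: main.
Unshelve. all: by end_near. Qed.
End density.
End lsi.

(** * Curvature of the generalised Cauchy density *)

Section cauchy_curvature.
Context {R : realType}.
Variable b : R.
Hypothesis hb : 2^-1 < b.
Implicit Types x : R.

Let c := (2 * b - 1)^-1.

Let b1 : 2 * b - 1 != 0. Proof. by have := hb => hb'; lra. Qed.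

Let c0 : 0 < c. Proof. by have := hb => hb'; rewrite invr_gt0; lra. Qed.

Definition cauchy_log x : R := 2 * b / (2 * b - 1) + ln (oneDsqr x).
Local Notation M := cauchy_log.

(** The weight of the inequality, normalised so that the constant in front of
the energy is the Gaussian constant [2]. *)
Definition cauchy_weight x : R := c * (oneDsqr x * M x).

Definition cauchy_scale x : R := Num.sqrt (cauchy_weight x).
Local Notation h := cauchy_scale.

Definition cauchy_scale_deriv x := c * x * (M x + 1) / h x.

(** The quantity [- h (ln (p h))'], simplified by means of
[h^2 = cauchy_weight]; see [cauchy_forceE]. *)
Definition cauchy_force x := x * (M x - c) / h x.

Definition cauchy_force_deriv x :=
  (M x - c + 2 * x ^+ 2 / oneDsqr x) / h x
  - x * (M x - c) * cauchy_scale_deriv x / h x ^+ 2.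

Lemma oneDsqr_pos x : 0 < oneDsqr x.
Proof. exact: lt_le_trans ltr01 (oneDsqr_ge1 x). Qed.

Lemma cauchy_log_ge x : 1 + c <= M x.
Proof.
rewrite /M; have -> : 2 * b / (2 * b - 1) = 1 + c by rewrite /c; field.
by rewrite lerDl ln_ge0 ?oneDsqr_ge1.
Qed.

Lemma cauchy_log_gt0 x : 0 < M x.
Proof. by apply: lt_le_trans (cauchy_log_ge x); rewrite addr_gt0. Qed.

Lemma cauchy_weight_gt0 x : 0 < cauchy_weight x.
Proof. by rewrite !mulr_gt0 ?oneDsqr_pos ?cauchy_log_gt0. Qed.

Lemma cauchy_scale_gt0 x : 0 < h x.
Proof. by rewrite sqrtr_gt0 cauchy_weight_gt0. Qed.

Lemma sqr_cauchy_scale x : h x ^+ 2 = cauchy_weight x.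
Proof. by rewrite sqr_sqrtr// ltW// cauchy_weight_gt0. Qed.

Lemma is_derive_oneDsqr x : is_derive x 1 oneDsqr (2 * x).
Proof.
have d0 := is_derive_id x (1 : R).
apply: is_derive_eq (is_derive1_funD (is_derive1_fun_cst 1 x)
  (is_derive1_funM d0 d0)) _.
by rewrite /=; ring.
Qed.

Lemma is_derive_cauchy_log x : is_derive x 1 M (2 * x / oneDsqr x).
Proof.
apply: is_derive_eq (is_derive1_funD
  (is_derive1_fun_cst (2 * b / (2 * b - 1)) x)
  (is_derive1_fun_ln (oneDsqr_pos x) (is_derive_oneDsqr x))) _.
by rewrite add0r.
Qed.

Lemma is_derive_cauchy_scale x : is_derive x 1 h (cauchy_scale_deriv x).
Proof.
have d1 := is_derive1_funZ c
  (is_derive1_funM (is_derive_oneDsqr x) (is_derive_cauchy_log x)).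
have d2 := is_derive1_comp (f := Num.sqrt) (g := cauchy_weight)
  (is_derive1_sqrt (cauchy_weight_gt0 x)) d1.
apply: is_derive_eq d2 _.
have := cauchy_scale_gt0 x; have := oneDsqr_pos x.
rewrite /cauchy_scale_deriv /h => o0 h0; field.
by rewrite !gt_eqF.
Qed.

Lemma is_derive_cauchy_force x :
  is_derive x 1 cauchy_force (cauchy_force_deriv x).
Proof.
have h0 := cauchy_scale_gt0 x; have o0 := oneDsqr_pos x.
have hn0 : h x != 0 by rewrite gt_eqF.
have d1 := is_derive1_funBc c (is_derive_cauchy_log x).
have d2 := is_derive1_funM (is_derive_id x (1 : R)) d1.
have d3 := is_derive1_funM d2 (is_derive1_funV hn0 (is_derive_cauchy_scale x)).
apply: is_derive_eq d3 _.
rewrite /cauchy_force_deriv /=; field.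
by rewrite !gt_eqF.
Qed.

(** With [s = x^2 / omega], so that [1 / omega = 1 - s], the product
is [1 + (1 - s) (M - c - 1) + s c / M]. It is at least [1] because [M] is at
least [2 b / (2 b - 1) = 1 + c]: this is where the additive constant of the
weight comes from. *)
Lemma cauchy_curvature x : 1 <= h x * cauchy_force_deriv x.
Proof.
have h0 := cauchy_scale_gt0 x; have o0 := oneDsqr_pos x.
have M0 := cauchy_log_gt0 x; have Mc := cauchy_log_ge x.
have -> : h x * cauchy_force_deriv x =
    1 + (1 / oneDsqr x * (M x - c - 1) + x ^+ 2 / oneDsqr x * c / M x).
  rewrite /cauchy_force_deriv /cauchy_scale_deriv.
  transitivity (M x - c + 2 * x ^+ 2 / oneDsqr x -
    x ^+ 2 * (M x - c) * c * (M x + 1) / h x ^+ 2).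
    by field; rewrite !gt_eqF.
  rewrite sqr_cauchy_scale /cauchy_weight /oneDsqr; field.
  by rewrite !gt_eqF.
rewrite lerDl addr_ge0//.
  by apply: mulr_ge0; [rewrite divr_ge0 ?ltW|rewrite subr_ge0 lerBrDr].
rewrite mulr_ge0 ?invr_ge0 ?(ltW M0)// mulr_ge0 ?(ltW c0)//.
by rewrite divr_ge0 ?sqr_ge0 ?(ltW o0).
Qed.

Definition gcauchy_pdf_deriv x := - (2 * b * x / oneDsqr x * gcauchy_pdf b x).

Lemma gcauchy_pdf_gt0 x : 0 < gcauchy_pdf b x.
Proof. by rewrite divr_gt0 ?gcauchy_mass_gt0// powR_gt0 ?oneDsqr_pos. Qed.

Lemma is_derive_gcauchy_pdf x :
  is_derive x 1 (gcauchy_pdf b) (gcauchy_pdf_deriv x).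
Proof.
have o0 := oneDsqr_pos x.
have d1 := is_derive1_comp (is_derive1_powR (- b) o0) (is_derive_oneDsqr x).
have d2 := is_derive1_funM d1 (is_derive1_fun_cst (gcauchy_mass b)^-1 x).
apply: is_derive_eq d2 _.
rewrite /gcauchy_pdf_deriv /gcauchy_pdf /gcauchy_fun.
rewrite powRB; last by apply/implyP => _; rewrite gt_eqF.
rewrite powRr1 ?(ltW o0)//=; field.
by rewrite !gt_eqF// gcauchy_mass_gt0.
Qed.

Lemma cauchy_forceE x : cauchy_force x =
  - (h x * gcauchy_pdf_deriv x / gcauchy_pdf b x + cauchy_scale_deriv x).
Proof.
have h0 := cauchy_scale_gt0 x; have o0 := oneDsqr_pos x.
have p0 := gcauchy_pdf_gt0 x; have M0 := cauchy_log_gt0 x.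
rewrite /cauchy_force /gcauchy_pdf_deriv /cauchy_scale_deriv.
transitivity ((2 * b * x / oneDsqr x * h x ^+ 2 - c * x * (M x + 1)) / h x).
  rewrite sqr_cauchy_scale /cauchy_weight /c; field.
  by rewrite b1 !gt_eqF.
by field; rewrite !gt_eqF.
Qed.

End cauchy_curvature.

(** * Integration against the generalised Cauchy probability *)

Section gcauchy_integral.
Context {R : realType}.
Variable b : R.
Hypothesis hb : 2^-1 < b.
Local Notation mu := (@lebesgue_measure R).
Local Notation nu := (gcauchy_prob hb).

(** The real line carries two measurable structures with the same measurable
sets, and Lebesgue measure lives on the other one than [gcauchy_prob]. This copy
of [gcauchy_prob] shares the structure of Lebesgue measure, so that the
Radon-Nikodym theorem applies to the pair. *)
Definition gcauchy_leb : set (measurableTypeR R) -> \bar R := gcauchy_prob hb.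

Let gcauchy_leb0 : gcauchy_leb set0 = 0%E.
Proof. exact: (measure0 nu). Qed.

Let gcauchy_leb_ge0 A : (0 <= gcauchy_leb A)%E.
Proof. exact: (measure_ge0 nu). Qed.

Let gcauchy_leb_sigma_additive : semi_sigma_additive gcauchy_leb.
Proof. exact: (@measure_semi_sigma_additive _ _ _ nu). Qed.

HB.instance Definition _ := isMeasure.Build _ _ _ gcauchy_leb
  gcauchy_leb0 gcauchy_leb_ge0 gcauchy_leb_sigma_additive.

Let gcauchy_leb_setT : gcauchy_leb setT = 1%E.
Proof. exact: (probability_setT nu). Qed.

HB.instance Definition _ := @Measure_isProbability.Build _ _ R
  gcauchy_leb gcauchy_leb_setT.

Lemma gcauchy_leb_dom : gcauchy_leb `<< mu.
Proof.
apply/null_content_dominatesP => A mA muA0.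
apply: null_set_integral => //.
apply/measurable_EFinP/measurable_funTS; exact: measurable_gcauchy_pdf.
Qed.

Lemma integral_gcauchy_leb (U : set (measurableTypeR R)) F : measurable U ->
  gcauchy_leb.-integrable U F ->
  (\int[gcauchy_leb]_(x in U) F x =
   \int[mu]_(x in U) (F x * (gcauchy_pdf b x)%:E))%E.
Proof.
move=> mU iF; have mF := measurable_int gcauchy_leb iF.
rewrite -(Radon_Nikodym_change_of_variables gcauchy_leb_dom)//=.
have mpdf V : measurable_fun V (EFin \o gcauchy_pdf b).
  by apply/measurable_EFinP/measurable_funTS; exact: measurable_gcauchy_pdf.
apply: ae_eq_integral => //.
- apply: emeasurable_funM => //; apply: (measurable_int mu).
  apply: (integrableS _ _ (@subsetT _ _)) => //=.
  by apply: Radon_Nikodym_integrable; exact: gcauchy_leb_dom.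
- by apply: emeasurable_funM => //; exact: mpdf.
- apply: ae_eqe_mul2l => /=.
  rewrite Radon_NikodymE//=; first exact: gcauchy_leb_dom.
  move=> numu; case: cid => /= h [h1 h2 h3].
  apply: integral_ae_eq => //=.
  + exact: integrableS h2.
  + exact: mpdf.
  + by move=> E EU mE; rewrite -h3.
Qed.

(** The two integrals are related by the identity map, which is measurable from
one structure to the other. *)
Lemma integral_gcauchy_prob_leb (U : set R) (F : R -> \bar R) : measurable U ->
  measurable_fun setT F -> gcauchy_leb.-integrable U F ->
  (\int[nu]_(x in U) F x = \int[gcauchy_leb]_(x in U) F x)%E.
Proof.
move=> mU mF iF.
have mid : measurable_fun setT (fun x : measurableTypeR R => x : R).
  by move=> _ B mB; rewrite setTI.
exact: (integral_pushforward mid mF iF mU).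
Qed.

Lemma Rintegral_gcauchy_prob (F : R -> R) (A : R) : continuous F ->
  (forall x, ~ (- A <= x <= A) -> F x = 0) ->
  \int[nu]_x F x = \int[mu]_(x in `[- A, A]) (F x * gcauchy_pdf b x).
Proof.
move=> cF F0.
have iF : gcauchy_leb.-integrable `[- A, A] (EFin \o F).
  apply: measurable_bounded_integrable => //.
  - by rewrite -ge0_fin_numE// fin_num_measure.
  - by apply: measurable_funTS; exact: continuous_measurable_fun.
  - have /compact_bounded[M [_ mrt]] := continuous_compact
      (continuous_subspaceT (A := `[- A, A]) cF) (@segment_compact _ _ _).
    by exists M; split; rewrite ?num_real // => ? ? ? ?; exact: mrt.
have -> : \int[nu]_x F x = \int[nu]_(x in `[- A, A]) F x.
  rewrite [RHS]Rintegral_mkcond; apply: eq_Rintegral => x _.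
  rewrite patchE; case: ifPn => //; rewrite notin_setE/= in_itv/= => /F0.
  by [].
rewrite /Rintegral integral_gcauchy_prob_leb//; last first.
  by apply/measurable_EFinP; exact: continuous_measurable_fun.
rewrite integral_gcauchy_leb//.
Qed.

Lemma cvg_gcauchy_pdf_segment :
  \int[mu]_(x in `[- n%:R, n%:R]) gcauchy_pdf b x @[n --> \oo] --> (1 : R).
Proof.
have H : nu `[- n%:R, n%:R]%classic @[n --> \oo] --> 1%E.
  rewrite -(probability_setT nu) -(@bigcup_itvT R true false).
  apply: (@nondecreasing_cvg_mu _ _ R nu
    (fun n => `[- n%:R, n%:R]%classic)) => //.
    by rewrite bigcup_itvT.
  apply/nondecreasing_seqP => n; rewrite subsetEset => x /=.
  by rewrite !in_itv/= -natr1 => /andP[? ?]; apply/andP; split; lra.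
exact: (fine_cvg H).
Qed.

End gcauchy_integral.

(** * Smooth functions with compact support *)

Section smooth_compact.
Context {R : realType}.
Variable f : R -> R.
Hypothesis hf : smooth_compact_support f.

Lemma smooth_is_derive (x : R) : is_derive x 1 f ((f^`())%classic x).
Proof.
by have [df _] := hf; rewrite derive1E; apply: derivableP; exact: (df 0%N).
Qed.

Lemma smooth_derive_continuous : continuous (f^`())%classic.
Proof.
have [df _] := hf => x.
apply/differentiable_continuous/derivable1_diffP.
by rewrite -derive1n1; exact: df.
Qed.

Lemma smooth_support_bounded : exists N : nat, forall x,
  ~ (- N%:R <= x <= N%:R) -> f x = 0 /\ (f^`())%classic x = 0.
Proof.
have [_ /compact_bounded[M [_ HM]]] := hf.
exists (Num.bound `|M + 1|) => x xN.
set N : R := (Num.bound `|M + 1|)%:R in xN *.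
have MN : M + 1 < N := le_lt_trans (ler_norm _) (archi_boundP (normr_ge0 _)).
have zero y : N < `|y| -> f y = 0.
  move=> Ny; apply/eqP/negP => /negP fy.
  have /(_ y) := HM (M + 1) (ltr_pwDr ltr01 (lexx M)).
  have cly : closure [set x | f x != 0] y by apply: subset_closure.
  move=> /(_ cly); apply/negP; rewrite -ltNge.
  exact: lt_trans Ny.
have Nx : N < `|x| by rewrite ltNge ler_norml; apply/negP.
split; first exact: zero.
rewrite derive1E; apply: derive_val.
(* Outside [[-N, N]], which is closed, [f] vanishes near [x]. *)
apply: (near_eq_is_derive (f := fun _ : R => 0 : R)).
have : \forall y \near x, N < `|y|.
  exact: (cvgr_gt `|x| (@norm_continuous _ _ (x : R)) N Nx).
by apply: filterS => y /zero ->.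
Qed.

End smooth_compact.

(** * The weighted logarithmic Sobolev inequality *)

Theorem corollary3p3 (R : realType) (b : R) (hb : 2^-1 < b) (f : R -> R)
    (hf : smooth_compact_support f) :
  entropy (gcauchy_prob hb) (fun x => f x ^+ 2) <=
  2 / (2 * b - 1) *
  \int[gcauchy_prob hb]_x
     ((f^`())%classic x ^+ 2 * oneDsqr x *
      (2 * b / (2 * b - 1) + ln (oneDsqr x))).
Proof.
have [N HN] := smooth_support_bounded hf.
have dfE := smooth_is_derive hf; have cdf := smooth_derive_continuous hf.
have cf : continuous f by move=> x; exact: is_derive_continuous (dfE x).
have cf2 : continuous (fun x => f x ^+ 2) by exact: continuous_funM.
set mu := @lebesgue_measure R; set p := gcauchy_pdf b.
set h := cauchy_scale b.
have cE : continuous (fun x => f x ^+ 2 * ln (f x ^+ 2)).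
  by move=> x; exact: (continuous_comp (cf2 x) (@continuous_xlnx R (f x ^+ 2))).
have ch : continuous h.
  by move=> x; exact: is_derive_continuous (is_derive_cauchy_scale hb x).
have cI : continuous (fun x => (f^`())%classic x ^+ 2 * h x ^+ 2).
  exact: continuous_funM (continuous_funM cdf cdf) (continuous_funM ch ch).
pose S := \int[gcauchy_prob hb]_x (f x ^+ 2).
pose I := \int[gcauchy_prob hb]_x ((f^`())%classic x ^+ 2 * h x ^+ 2).
have -> : 2 / (2 * b - 1) * \int[gcauchy_prob hb]_x
     ((f^`())%classic x ^+ 2 * oneDsqr x *
      (2 * b / (2 * b - 1) + ln (oneDsqr x))) = 2 * I.
  have cG : continuous (fun x => (f^`())%classic x ^+ 2 * oneDsqr x *
      (2 * b / (2 * b - 1) + ln (oneDsqr x))).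
    apply: continuous_funM; last first.
      by move=> x; exact: is_derive_continuous (is_derive_cauchy_log b x).
    exact: continuous_funM (continuous_funM cdf cdf) continuous_oneDsqr.
  rewrite -mulrA; congr (2 * _).
  rewrite /I !(@Rintegral_gcauchy_prob _ _ hb _ N%:R)//; last 2 first.
  - by move=> x /HN[_ ->]; rewrite expr0n/= mul0r.
  - by move=> x /HN[_ ->]; rewrite expr0n/= !mul0r.
  rewrite -RintegralZl//; last first.
    apply: continuous_integrable_segment; apply: continuous_funM cG _.
    by move=> x; exact: is_derive_continuous (is_derive_gcauchy_pdf hb x).
  apply: eq_Rintegral => x _.
  rewrite /h sqr_cauchy_scale// /cauchy_weight /cauchy_log; ring.
rewrite /entropy -/S lerBlDr.
pose Z (n : nat) := \int[mu]_(x in `[- n%:R, n%:R]) p x.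
have cZ : Z @ \oo --> (1 : R) by exact: cvg_gcauchy_pdf_segment.
have main n : (N <= n)%N -> (0 < n)%N ->
    \int[gcauchy_prob hb]_x (f x ^+ 2 * ln (f x ^+ 2)) <=
    2 * I + Z n * (S / Z n * ln (S / Z n)).
  move=> Nn n0.
  have out x : ~ (- n%:R <= x <= n%:R) -> f x = 0 /\ (f^`())%classic x = 0.
    move=> xn; apply: HN => /andP[x1 x2]; apply: xn.
    have : N%:R <= n%:R :> R by rewrite ler_nat.
    by move=> ?; apply/andP; split; lra.
  rewrite /S /I !(@Rintegral_gcauchy_prob _ _ hb _ n%:R)//.
  2-4: by move=> x /out[fx dfx]; rewrite ?fx ?dfx expr0n/= ?mul0r.
  apply: (log_sobolev_segment_sqr (is_derive_gcauchy_pdf hb)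
    (is_derive_cauchy_scale hb) (is_derive_cauchy_force hb) (gcauchy_pdf_gt0 hb)
    (cauchy_scale_gt0 hb) (cauchy_forceE hb) (cauchy_curvature hb)) => //.
  have : 0 < n%:R :> R by rewrite ltr0n.
  by move=> ?; lra.
(* As the mass [Z n] tends to [1], the last term tends to [S * ln S]. *)
apply: (@ler_cvg_to _ \oo _ _
  (fun _ => \int[gcauchy_prob hb]_x (f x ^+ 2 * ln (f x ^+ 2)))
  (fun n => 2 * I + Z n * (S / Z n * ln (S / Z n)))).
- exact: cvg_cst.
- have -> : 2 * I + S * ln S = 2 * I + 1 * (S / 1 * ln (S / 1)).
    by rewrite divr1 mul1r.
  apply: cvgD; first exact: cvg_cst.
  apply: (cvgM cZ).
  have cSZ : S / Z n @[n --> \oo] --> S / 1.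
    apply: cvgM; first exact: cvg_cst.
    by apply: (cvgV _ cZ); rewrite oner_eq0.
  exact: (continuous_cvg _ (@continuous_xlnx R (S / 1)) cSZ).
- near=> n; apply: main; near: n; [exact: nbhs_infty_ge|exact: nbhs_infty_gt].
Unshelve. all: by end_near. Qed.
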